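(* Let $T$ be a complete binary tree with height $h$, then $\mathrm{thin}(T) = \lceil\frac{h+1}{3}\rceil$.
   Context: A graph $G$ is $k$-thin if there exist a strict total order $\prec$ on $V(G)$ and a partition of $V(G)$ into $k$ classes such that for all $u \prec v \prec w$ with $u,v$ in the same class and $(u,w)\in E(G)$, also $(v,w)\in E(G)$; the thinness $\mathrm{thin}(G)$ is the minimum such $k$. A complete binary tree is a rooted tree in which every non-leaf vertex has 2 children and all leaves are at the same distance from the root; the height is the maximum number of edges on a path from the root to a leaf. *)

(* Defs.v *)
From mathcomp Require Import all_boot all_order all_algebra.

Set Implicit Arguments.
Unset Strict Implicit.
Unset Printing Implicit Defensive.

(* A finite graph is an adjacency relation [e : rel V] on a finType [V]. *)
Definition simple_graph (V : finType) (e : rel V) : Prop :=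
  symmetric e /\ irreflexive e.

Section Thinness.

Variables (V : finType) (e : rel V).

(* Orders are coded as sets of pairs so that [k_thin] is decidable and [thin]
   can be a function; [k_thinP] restates [k_thin] with an arbitrary relation. *)
Definition strict_total_order (R : {set V * V}) : bool :=
  [&& [forall x, (x, x) \notin R],
      [forall x, forall y, forall z,
         ((x, y) \in R) && ((y, z) \in R) ==> ((x, z) \in R)]
    & [forall x, forall y, (x != y) ==> ((x, y) \in R) || ((y, x) \in R)]].

Definition consistent (R : {set V * V}) (P : {set {set V}}) : bool :=
  [forall u, forall v, forall w,
     [&& (u, v) \in R, (v, w) \in R, pblock P u == pblock P v & e u w]
       ==> e v w].

Definition k_thin (k : nat) : bool :=
  [exists R : {set V * V}, exists P : {set {set V}},
     [&& strict_total_order R, partition P [set: V], #|P| == k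
       & consistent R P]].

Lemma k_thinP (k : nat) :
  reflect (exists (lt : rel V) (P : {set {set V}}),
             [/\ irreflexive lt, transitive lt
               & forall x y, x != y -> lt x y || lt y x]
             /\ [/\ partition P [set: V], #|P| = k
                  & forall u v w, lt u v -> lt v w ->
                      pblock P u = pblock P v -> e u w -> e v w])
          (k_thin k).
Proof.
apply: (iffP existsP) => [[R /existsP[P]]|[lt [P [[irr tr tot] [pP kP cP]]]]].
  case/and4P=> /and3P[/forallP irr /forallP tr /forallP tot] pP /eqP kP.
  move=> /forallP cP; exists (fun x y => (x, y) \in R), P; split; split=> //.
  - by move=> x; apply: negbTE.
  - move=> y x z xy yz; move/forallP/(_ y)/forallP/(_ z): (tr x).
    by rewrite xy yz.
  - by move=> x y xy; move/forallP/(_ y): (tot x); rewrite xy.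
  - move=> u v w uv vw puv uw; move/forallP/(_ v)/forallP/(_ w): (cP u).
    by rewrite uv vw puv eqxx uw.
exists [set p | lt p.1 p.2]; apply/existsP; exists P; apply/and4P.
split=> //; last 2 first.
- exact/eqP.
- apply/forallP=> u; apply/forallP=> v; apply/forallP=> w; apply/implyP.
  by rewrite !inE /= => /and4P[uv vw /eqP puv uw]; apply: (cP u).
apply/and3P; split; apply/forallP=> x; first by rewrite inE /= irr.
- apply/forallP=> y; apply/forallP=> z; rewrite !inE /=.
  by apply/implyP=> /andP[]; apply: tr.
- apply/forallP=> y; rewrite !inE /=; apply/implyP; exact: tot.
Qed.

Lemma ex_k_thin : exists k, k_thin k.
Proof.
exists #|preim_partition (@id V) [set: V]|; apply/k_thinP.
have pP := preim_partitionP (@id V) [set: V].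
exists (fun x y => (enum_rank x < enum_rank y)%N),
  (preim_partition (@id V) [set: V]); split; split=> //.
- by move=> x; rewrite ltnn.
- by move=> y x z; apply: ltn_trans.
- by move=> x y; rewrite -neq_ltn -(inj_eq enum_rank_inj).
move=> u v w _ _ puv uw; suff -> : v = u by [].
case/and3P: pP => /eqP cov triv _.
have : v \in pblock (preim_partition (@id V) [set: V]) u.
  by rewrite puv mem_pblock cov inE.
rewrite pblock_equivalence_partition ?inE // => [/eqP|]; first by [].
by split=> // /eqP ->.
Qed.

Definition thin : nat := ex_minn ex_k_thin.

End Thinness.

Section RootedTree.

Variables (V : finType) (e : rel V).

(* [ucycle e [:: x; y]] holds for every edge, so only duplicate-free cycles
   with at least 3 vertices are excluded. *)
Definition is_tree : Prop :=
  (forall x y, connect e x y) /\ (forall c, ucycle e c -> size c < 3).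

(* Number of edges of a shortest path; the junk value is [#|V|]. *)
Definition dist (x y : V) : nat :=
  find (fun n => [exists p : n.-tuple V, path e x p && (last x p == y)])
       (iota 0 #|V|).

Variable r : V.

Definition children (v : V) : {set V} :=
  [set u | e v u && (dist r u == (dist r v).+1)].

Definition leaf (v : V) : bool := children v == set0.

Definition complete_binary_tree : Prop :=
  [/\ is_tree,
      forall v, ~~ leaf v -> #|children v| = 2
    & forall u v, leaf u -> leaf v -> dist r u = dist r v].

(* A path [r :: p] without repeated vertices has [size p < #|V|] edges. *)
Definition height : nat :=
  \max_(n < #|V| | [exists p : n.-tuple V,
                      [&& path e r p, uniq (r :: p) & leaf (last r p)]]) n.

End RootedTree.

(* Main.v *)
(* Vertices are coded by the words of turns leading to them from the root.

   Upper bound: colour a vertex by its depth divided by 3. Inside a triple of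
   levels, the root of the triple, its children and its grandchildren form a
   caterpillar, hence have an order that is consistent with a single class; the
   subtrees below are inserted right after the grandchild carrying them.

   Lower bound: fix an order. If t is a vertex and (a_i, b_i) are k edges with
   a_i < t < b_i such that neither t nor a_j (j <> i) is adjacent to b_i, then
   t, a_1, ..., a_k lie in distinct classes. Such a configuration with k = h / 3
   exists by induction: below a vertex of height h there are three subtrees of
   height at least h - 3, any two of which are joined by a path avoiding the closed
   neighbourhood of the third. Among their three configurations take the one
   whose t is in the middle; the path joining the other two centres crosses it
   and supplies one more edge. *)
Require Import Defs.
From mathcomp Require Import all_boot all_order all_algebra.
From mathcomp Require Import lra.
From Stdlib Require Import Relation_Operators.

Set Implicit Arguments.
Unset Strict Implicit.
Unset Printing Implicit Defensive.

Import GRing.Theory Num.Theory.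

(** * Binary words as tree vertices, and the order for the upper bound *)

Definition wchild (s t : seq bool) : bool :=
  prefix s t && (size t == (size s).+1).

Definition wadj (s t : seq bool) : bool := wchild s t || wchild t s.

Lemma wadjC : symmetric wadj.
Proof. by move=> s t; rewrite /wadj orbC. Qed.

Lemma wchild_cons x y s t :
  wchild (x :: s) (y :: t) = (x == y) && wchild s t.
Proof. by rewrite /wchild prefix_cons /= eqSS -andbA. Qed.

Lemma wchild_rcons s b : wchild s (rcons s b).
Proof. by rewrite /wchild prefix_rcons size_rcons eqxx. Qed.

Lemma wchildP s t : reflect (exists b, t = rcons s b) (wchild s t).
Proof.
apply: (iffP idP) => [|[b ->]]; last exact: wchild_rcons.
case/andP=> /prefixP[u ->]; rewrite size_cat -addn1 eqn_add2l.
by case: u => [|b []] // _; exists b; rewrite cats1.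
Qed.

Lemma wadj_cons x y s t :
  wadj (x :: s) (y :: t) =
  if (x == y) then wadj s t else false.
Proof. by rewrite /wadj !wchild_cons eq_sym; case: eqP. Qed.

(* The in-order layout of three levels of the tree: the subtrees hanging from a
   grandchild [x; y] of the root directly follow it, and the rest is arranged as
   00 < 01 < 0 < [::] < 10 < 11 < 1, so that the earlier
   neighbours of a vertex form a final segment of what precedes it in each
   triple of levels. *)
Fixpoint key (s : seq bool) : seq nat :=
  match s with
  | [::] => [:: 3]
  | [:: x] => [:: 4 * x + 2]
  | [:: x; y] => [:: 4 * x + y]
  | x :: y :: z :: s' => 4 * x + y :: nat_of_bool z :: key s'
  end.

Definition word_lt (s t : seq bool) : bool :=
  Order.lt (key s : seqlexi nat) (key t).

Lemma word_lt_irr : irreflexive word_lt.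
Proof. by move=> s; rewrite /word_lt Order.POrderTheory.ltxx. Qed.

Lemma word_lt_trans : transitive word_lt.
Proof. by move=> t s u; apply: Order.POrderTheory.lt_trans. Qed.

(** The first entry is 3, or 2 or 6, or one of 0, 1, 4, 5 according to whether the word has no, one
    or more letters, and it determines the first two of them. A third letter and the rest follow in
    the tail. *)
Lemma key_inj : injective key.
Proof.
move=> s; have [n] := ubnP (size s); elim: n s => // n IHn s sn t.
case: s sn => [|x [|y [|z s]]] sn; case: t => [|x' [|y' [|z' t]]] //=;
  repeat match goal with b : bool |- _ => case: b sn => sn end; try by [].
all: by case=> /IHn-> //; move: sn; rewrite /= !ltnS => /ltnW/ltnW.
Qed.

Lemma word_lt_total s t : s != t -> word_lt s t || word_lt t s.
Proof.
rewrite -(inj_eq key_inj) => neq_st.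
by rewrite -[_ || _](Order.TotalTheory.neq_lt (key s : seqlexi nat)).
Qed.

Lemma word_lt_block x y z s x' y' z' t :
  word_lt [:: x, y, z & s] [:: x', y', z' & t] =
  [|| 4 * x + y < 4 * x' + y',
      (x == x') && (y == y') && (z < z') |
      (x == x') && (y == y') && (z == z') && word_lt s t].
Proof.
rewrite /word_lt /= !Order.SeqLexiOrder.Exports.ltxi_cons.
by case: x; case: y; case: z; case: x'; case: y'; case: z'.
Qed.

Lemma word_lt_block_between x y z s x' y' z' t u :
  word_lt [:: x, y, z & s] [:: x', y', z' & t] ->
  word_lt [:: x', y', z' & t] [:: x, y, z & u] ->
  [/\ x' = x, y' = y, z' = z, word_lt s t & word_lt t u].
Proof.
by rewrite !word_lt_block; case: x; case: x'; case: y; case: y'; case: z; case: z'.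
Qed.

Lemma word_lt_consistent s t u :
  word_lt s t -> word_lt t u -> size s %/ 3 = size t %/ 3 -> wadj s u -> wadj t u.
Proof.
have long x y z (w : seq bool) : size [:: x, y, z & w] %/ 3 = (size w %/ 3).+1.
  by rewrite /= -addn3 divnDr // addn1.
have [n] := ubnP (size s); elim: n s t u => // n IHn s t u.
case: s => [|x [|y [|z s]]]; case: t => [|x' [|y' [|z' t]]] sn;
  rewrite ?long //; last first.
  case: u => [|x2 [|y2 [|z2 u]]]; rewrite ?wadj_cons; try by repeat case: (_ == _).
    (* A two-letter [u] adjacent to the longer [s] is its parent and so precedes it, against [s] <
       [t] < [u]. *)
    move=> st /(word_lt_trans st) su _.
    by case: x y x2 y2 su {sn st} => [] [] [] [].
  case: eqP => // <-; case: eqP => // <-; case: eqP => // <- st tu [sz] su.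
  case: (word_lt_block_between st tu) => -> -> -> {}st {}tu; rewrite !eqxx.
  by apply: IHn sz su => //; move: sn; rewrite /= !ltnS => /ltnW/ltnW.
all: case: u => [|x2 [|y2 [|z2 u]]].
all: repeat match goal with b : bool |- _ => case: b sn => sn end; try by [].
Qed.

(** * Walks inside a set of words, and vertices away from a subtree *)

Definition linked (C : pred (seq bool)) : seq bool -> seq bool -> Prop :=
  clos_refl_sym_trans _ (fun s t => [&& wadj s t, C s & C t]).

(** Membership in [R] has to change at some step of the walk; symmetry of [wadj] lets that step be
    read as leaving [R]. *)
Lemma linked_crossing C (R : pred (seq bool)) s t :
  linked C s t -> R s != R t ->
  exists a b, [/\ wadj a b, C a, C b, R a & ~~ R b].
Proof.
elim=> {s t} [s t /and3P[st Cs Ct]|s|s t _ IH|s t u _ IHst _ IHtu].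
- case Rs: (R s); case Rt: (R t) => // _; last by exists t, s; rewrite wadjC Rs Rt.
  by exists s, t; rewrite Rs Rt.
- by rewrite eqxx.
- by rewrite eq_sym.
by move: (R t) IHst IHtu; case: (R s); case: (R u) => // -[] IHst IHtu _; auto.
Qed.

Lemma prefix_rcons_eq (u w : seq bool) b :
  prefix u (rcons w b) = (u == rcons w b) || prefix u w.
Proof.
elim: w u => [|y w IHw] [|x u] //; rewrite [rcons _ _]/= prefix_cons eqseq_cons.
  by rewrite prefixs0 orbF.
by rewrite prefix_cons IHw andb_orr.
Qed.

Lemma prefix_comparable (u v w : seq bool) :
  prefix u w -> prefix v w -> prefix u v || prefix v u.
Proof.
elim: w u v => [|z w IHw] [|x u] [|y v] //=.
by move=> /andP[/eqP-> uw] /andP[/eqP-> vw]; rewrite !eqxx; apply: IHw.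
Qed.

Lemma wadj_cat s u w : wadj (s ++ u) (s ++ w) = wadj u w.
Proof. by elim: s => //= x s IHs; rewrite wadj_cons eqxx. Qed.

(* [w] lies outside the closed neighbourhood of the subtree rooted at [u]. *)
Definition far (u w : seq bool) : bool := ~~ prefix u w && ~~ wchild w u.

Lemma far_cat s u w : far (s ++ u) (s ++ w) = far u w.
Proof. by elim: s => //= x s; rewrite /far wchild_cons /= eqxx. Qed.

Lemma far_nonadj u w t : far u w -> prefix u t -> ~~ wadj w t.
Proof.
case/andP=> uw wu ut; apply: contra uw => /orP[] /wchildP[b tE]; last first.
  by rewrite tE prefix_rcons_eq ut orbT.
move: ut; rewrite tE prefix_rcons_eq => /predU1P[uE|//].
by rewrite uE wchild_rcons in wu.
Qed.

Lemma far_subtree u v w :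
  ~~ prefix u v -> ~~ prefix v u -> prefix u w -> far v w.
Proof.
move=> uv vu uw; apply/andP; split.
  by apply/negP=> /(prefix_comparable uw); rewrite (negPf uv) (negPf vu).
by apply: contra uv => /andP[wv _]; apply: prefix_trans uw wv.
Qed.

(** * Configurations for the lower bound *)

Section Witness.

Variables (lt : rel (seq bool)) (n : nat).
Hypothesis lt_total : forall s t,
  size s <= n -> size t <= n -> s != t -> lt s t = ~~ lt t s.

Definition separated (p q : seq bool * seq bool) : bool :=
  ~~ wadj p.1 q.2 && ~~ wadj q.1 p.2.

(* The edge [p] jumps over [t] in the order, and its far end misses [t]. *)
Definition crosses (s t : seq bool) (p : seq bool * seq bool) : bool :=
  [&& prefix s p.1 && (size p.1 <= n), prefix s p.2 && (size p.2 <= n),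
      wadj p.1 p.2, lt p.1 t, lt t p.2 & ~~ wadj t p.2].

Definition witness (k : nat) (s t : seq bool) (m : seq (seq bool * seq bool)) :=
  [/\ prefix s t && (size t <= n), size m = k, pairwise separated m
    & all (crosses s t) m].

Definition apart (s u w : seq bool) : bool :=
  [&& prefix s w, size w <= n & far u w].

(** The walk passes from one side of [t] to the other, so one of its edges jumps over [t]. Both ends
    of that edge are far from [u], hence adjacent neither to [t] nor to an end of an old edge. *)
Lemma witness_extend k s u t m a b :
  prefix s u -> witness k u t m -> linked (apart s u) a b ->
  lt a t != lt b t -> exists m', witness k.+1 s t m'.
Proof.
move=> su [/andP[ut tn] mk sep cross] ab ltab.
have [c [d [cd /and3P[sc cn uc] /and3P[sd dn ud] ct dt]]] :=
  linked_crossing (R := lt^~ t) ab ltab.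
exists ((c, d) :: m); split=> //=; first by rewrite (prefix_trans su ut).
- by rewrite mk.
- rewrite sep andbT; apply/allP=> p /(allP cross) /and3P[/andP[p1 _] /andP[p2 _] _].
  by rewrite /separated /= (far_nonadj uc p2) wadjC (far_nonadj ud p1).
apply/andP; split; last first.
  apply: sub_all cross => p /and3P[/andP[p1 ?] /andP[p2 ?] ?].
  by apply/and3P; split=> //; rewrite (prefix_trans su).
rewrite /crosses /= sc cn sd dn cd ct wadjC (far_nonadj ud ut) andbT /=.
(* [d] differs from [t], which lies in the subtree at [u]; not being before [t], it comes after
   it. *)
rewrite lt_total ?dt //; apply: contraTneq ut => ->.
by case/andP: ud.
Qed.

Lemma linked_subtree (C : pred (seq bool)) u t :
  (forall w, prefix u w -> size w <= n -> C w) ->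
  prefix u t -> size t <= n -> linked C t u.
Proof.
move=> CP /prefixP[w ->]; elim/last_ind: w => [|w b IHw] wn.
  by rewrite cats0; apply: rst_refl.
have wn' : size (u ++ w) <= n.
  by apply: leq_trans wn; rewrite !size_cat size_rcons addnS.
apply: rst_trans (IHw wn'); apply: rst_step.
rewrite !CP ?prefix_prefix // !andbT wadj_cat wadjC.
by rewrite /wadj wchild_rcons.
Qed.

(* [u], [v], [c] is a path, and the subtree at [u] together with this path
   avoids the closed neighbourhood of the subtree at [j]. *)
Definition arm (u v c j : seq bool) : bool :=
  [&& far j v, far j c, ~~ prefix u j, ~~ prefix j u, wadj u v, wadj v c,
      size u <= 3, size v <= 3 & size c <= 3].

(** Climb from [t] to the root of its subtree, then follow the two edges of the arm. *)
Lemma linked_arm s u v c j t :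
  size s + 3 <= n -> arm u v c j ->
  prefix (s ++ u) t -> size t <= n -> linked (apart s (s ++ j)) t (s ++ c).
Proof.
move=> sn /and5P[jv jc uj ju /and5P[uv vc u3 v3 c3]] ut tn.
have small w : size w <= 3 -> size (s ++ w) <= n.
  by move=> w3; apply: leq_trans sn; rewrite size_cat leq_add2l.
have ju' : far j u by apply: (far_subtree uj ju); apply: prefix_refl.
have Cs w : size w <= 3 -> far j w -> apart s (s ++ j) (s ++ w).
  by move=> w3 jw; rewrite /apart prefix_prefix small // far_cat.
apply: rst_trans (_ : linked _ t (s ++ u)) _.
  apply: linked_subtree => // w uw wn; rewrite /apart wn.
  rewrite (prefix_trans (prefix_prefix s u) uw) /=.
  apply: far_subtree uw; first by rewrite prefix_catr // eqxx.
  by rewrite prefix_catr // eqxx.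
by apply: rst_trans (_ : linked _ (s ++ u) (s ++ v)) _; apply: rst_step;
  rewrite wadj_cat !Cs // ?uv ?vc.
Qed.

Lemma ex_witness k s : size s + 3 * k <= n -> exists t m, witness k s t m.
Proof.
elim: k s => [|k IHk] s sn.
  by exists s, [::]; split; rewrite ?prefix_refl //= -(addn0 (size s)).
have s3 : size s + 3 <= n by apply: leq_trans sn; rewrite leq_add2l mulnS leq_addr.
have IH w : size w <= 3 -> exists t m, witness k (s ++ w) t m.
  move=> w3; apply: IHk; apply: leq_trans sn.
  by rewrite size_cat mulnS -addnA !leq_add2l leq_add2r.
(* The parents of these three roots are the three neighbours of the hub [c]. A route through [c]
   between two of the subtrees thus misses the parent of the third, the only outside vertex adjacent
   to it. *)
pose u1 := [:: false; false; false]; pose u2 := [:: false; true; false].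
pose u3 := [:: true]; pose c := [:: false].
have [t1 [m1 W1]] := IH u1 isT; have [t2 [m2 W2]] := IH u2 isT.
have [t3 [m3 W3]] := IH u3 isT.
have cross i vi l vl j ti tl tj mj mi ml :
    witness k (s ++ i) ti mi -> witness k (s ++ l) tl ml ->
    witness k (s ++ j) tj mj -> arm i vi c j -> arm l vl c j ->
    lt ti tj != lt tl tj -> exists t m, witness k.+1 s t m.
  move=> [/andP[iti tin] _ _ _] [/andP[ltl tln] _ _ _] Wj ai al neq; exists tj.
  apply: witness_extend (prefix_prefix s j) Wj _ neq.
  apply: rst_trans (linked_arm s3 ai iti tin) _.
  by apply: rst_sym; apply: linked_arm s3 al ltl tln.
(* If each [tj] had the other two on the same side, the three pairs would be
   oriented inconsistently. *)
have [e2|] := eqVneq (lt t1 t2) (lt t3 t2); last first.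
  exact: (cross u1 [:: false; false] u3 [::] _ _ _ _ _ _ _ W1 W3 W2).
have [e1|] := eqVneq (lt t2 t1) (lt t3 t1); last first.
  exact: (cross u2 [:: false; true] u3 [::] _ _ _ _ _ _ _ W2 W3 W1).
have [e3|] := eqVneq (lt t1 t3) (lt t2 t3); last first.
  exact: (cross u1 [:: false; false] u2 [:: false; true] _ _ _ _ _ _ _ W1 W2 W3).
have neq u v t t' m m' : ~~ prefix u v -> ~~ prefix v u ->
    witness k (s ++ u) t m -> witness k (s ++ v) t' m' -> lt t t' = ~~ lt t' t.
  move=> uv vu [/andP[ut tn] _ _ _] [/andP[vt' tn'] _ _ _]; apply: lt_total => //.
  apply: contraTneq ut => ->; apply: contra uv => ut'.
  have := prefix_comparable ut' vt'.
  by rewrite !prefix_catr // eqxx /= (negPf vu) orbF.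
have := neq u1 u2 _ _ _ _ isT isT W1 W2; rewrite e1 e2.
rewrite (neq u3 u2 _ _ _ _ isT isT W3 W2) (neq u3 u1 _ _ _ _ isT isT W3 W1) -e3.
by case: (lt t1 t3).
Qed.

End Witness.

Lemma uniq_cons_size (T : finType) (x : T) (p : seq T) :
  uniq (x :: p) -> size p < #|T|.
Proof. by move=> /card_uniqP xp; rewrite -[_.+1]/(size (x :: p)) -xp max_card. Qed.

(** * Levels of a complete binary tree and its coding by words *)

Section Tree.

Variables (V : finType) (e : rel V) (r : V).
Hypotheses (e_simple : simple_graph e) (e_tree : is_tree e).
Local Notation d := (dist e r).

Let e_sym : symmetric e. Proof. by case: e_simple. Qed.
Let e_irr : irreflexive e. Proof. by case: e_simple. Qed.

Lemma dist_leq p : path e r p -> d (last r p) <= size p.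
Proof.
case/shortenP=> q q_path q_uniq q_sub.
have pq : size q <= size p.
  by apply: uniq_leq_size => //; case/andP: q_uniq.
apply: leq_trans pq; rewrite /dist leqNgt; apply/negP => /(before_find 0).
have qV := uniq_cons_size q_uniq.
rewrite nth_iota // add0n => /existsP[]; exists (in_tuple q).
by rewrite /= q_path eqxx.
Qed.

(** Connectedness keeps [dist] off its junk value: a duplicate-free path has fewer than [#|V|]
    edges, within the range searched. *)
Lemma dist_path x : exists2 p, path e r p & last r p = x /\ size p = d x.
Proof.
have /connectP[p0 /shortenP[q q_path q_uniq _] ->] := e_tree.1 r x.
have qV := uniq_cons_size q_uniq.
set P := fun n => [exists p : n.-tuple V, path e r p && (last r p == last r q)].
have hasP : has P (iota 0 #|V|).
  apply/hasP; exists (size q); first by rewrite mem_iota.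
  by apply/existsP; exists (in_tuple q); rewrite /= q_path eqxx.
have := nth_find 0 hasP; rewrite nth_iota ?add0n; last first.
  by rewrite -{2}(size_iota 0 #|V|) -has_find.
case/existsP=> p /andP[p_path /eqP p_last]; exists p => //; split => //.
exact: size_tuple.
Qed.

Lemma dist_root : d r = 0.
Proof. by apply/eqP; rewrite -leqn0; apply: (@dist_leq [::]). Qed.

Lemma dist_edge x y : e x y -> d y <= (d x).+1.
Proof.
move=> xy; have [p p_path [px <-]] := dist_path x.
rewrite -(size_rcons p y) -{1}(last_rcons r p y); apply: dist_leq.
by rewrite rcons_path p_path px.
Qed.

Lemma ex_parent x : x != r -> exists2 y, e x y & d x = (d y).+1.
Proof.
have [p + [<-]] := dist_path x; case/lastP: p => [|p y]; first by rewrite eqxx.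
rewrite rcons_path last_rcons size_rcons => /andP[p_path py] dE _.
exists (last r p); first by rewrite e_sym.
by apply/eqP; rewrite eqn_leq dist_edge // -dE ltnS dist_leq.
Qed.

(** Otherwise the walk, shortened and closed up through [v], is a cycle on at least 3 vertices. *)
Lemma no_detour v u u' :
  e v u -> e v u' ->
  connect [rel x y | [&& e x y, x != v & y != v]] u u' -> u = u'.
Proof.
move=> vu vu' /connectP[p /shortenP[q q_path q_uniq _] u'E].
have e_path : path e u q by apply: sub_path q_path => x y /and3P[].
have v_notin : v \notin u :: q.
  rewrite inE negb_or; apply/andP; split.
    by apply: contraTneq vu => ->; rewrite e_irr.
  elim: q u q_path {vu q_uniq u'E e_path} => //= y q IHq u.
  by case/andP=> /and3P[_ _ yv] /IHq; rewrite inE eq_sym negb_or yv.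
have := e_tree.2 [:: v, u & q]; rewrite /ucycle /ucycleb cons_uniq v_notin q_uniq.
rewrite /cycle [path _ _ _]/= vu rcons_path e_path -u'E e_sym vu' => /(_ isT).
by case: q u'E {q_path q_uniq e_path v_notin} => //= ->.
Qed.

(** Going from parent to parent, all vertices after [u] are strictly closer to the root than [v]. *)
Lemma connect_root v u : d u <= d v -> u != v ->
  connect [rel x y | [&& e x y, x != v & y != v]] r u.
Proof.
move: {2}(d u) (erefl (d u)) => n; elim: n u => [|n IHn] u un uv neq_uv.
  by case: (eqVneq u r) => [->|/ex_parent[y _]]; rewrite ?un.
have ur : u != r by apply: contra_eq_neq un => ->; rewrite dist_root.
have [y uy] := ex_parent ur; rewrite un => -[yn].
have yv : y != v by apply: contraTneq uv => <-; rewrite un -ltnNge yn.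
apply: connect_trans (IHn y _ _ yv) _ => //; first by apply: leq_trans uv; rewrite un yn.
by apply: connect1; rewrite /= e_sym uy yv.
Qed.

(** Both neighbours reach the root without meeting [v], so [no_detour] applies. Allowing equal
    levels also serves to exclude edges within a level. *)
Lemma unique_parent v u u' : e v u -> e v u' -> d u <= d v -> d u' <= d v -> u = u'.
Proof.
move=> vu vu' duv du'v; apply: (no_detour vu vu').
have neq w : e v w -> w != v by apply: contraTneq => ->; rewrite e_irr.
have sym : connect_sym [rel x y | [&& e x y, x != v & y != v]].
  by apply: sym_connect_sym => x y /=; rewrite e_sym andbCA andbC -andbA andbC.
apply: connect_trans (connect_root du'v (neq _ vu')).
by rewrite sym; apply: connect_root duv (neq _ vu).
Qed.

Lemma edge_levels x y : e x y -> (d y == (d x).+1) || (d x == (d y).+1).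
Proof.
move=> xy; have yx : e y x by rewrite e_sym.
wlog le_xy : x y xy yx / d x <= d y.
  by move=> W; case: (leqP (d x) (d y)) => [|/ltnW] /W; [|rewrite orbC]; apply.
case: (eqVneq y r) => [yr|/ex_parent[z yz dyz]].
  have xr : x != r by apply: contraTneq xy => ->; rewrite yr e_irr.
  have [z _ xz] := ex_parent xr.
  by move: le_xy; rewrite yr dist_root xz.
rewrite (unique_parent yx yz) //; first by rewrite dyz eqxx.
by rewrite dyz leqnSn.
Qed.

(** Once a path has stepped down it cannot turn back: the only neighbour that is not deeper is the
    vertex just left. *)
Lemma descending_path p x :
  path e x p -> uniq (x :: p) ->
  (forall y, e x y -> d y <= d x -> y \notin p) ->
  d (last x p) = d x + size p.
Proof.
elim: p x => [|y p IHp] x /=; first by rewrite addn0.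
case/andP=> xy yp /and3P[x_notin y_notin p_uniq] xP.
have yx : e y x by rewrite e_sym.
have dy : d y = (d x).+1.
  have := edge_levels xy => /orP[/eqP //|/eqP dE].
  by have := xP y xy; rewrite dE leqnSn mem_head => /(_ isT).
rewrite IHp /= ?dy ?addSnnS ?y_notin // => z yz dz.
have -> : z = x by apply: unique_parent yz yx _ _; rewrite ?dy.
by move: x_notin; rewrite inE negb_or => /andP[].
Qed.

Hypothesis e_cbt : complete_binary_tree e r.

(** A deepest vertex [w] is a leaf and all leaves share its level. Duplicate-free paths from the
    root only descend, so [height] is the level of [w]. *)
Lemma cbt_levels : (forall v, d v <= height e r) /\
  (forall v, leaf e r v = (d v == height e r)).
Proof.
have [_ _ leaves] := e_cbt.
pose w := [arg max_(v > r) d v]; have wmax v : d v <= d w.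
  by rewrite /w; case: arg_maxnP => // u _ /(_ v isT).
have w_leaf : leaf e r w.
  apply/eqP/setP => u; rewrite !inE; apply/negP => /andP[_ /eqP du].
  by have := wmax u; rewrite du ltnn.
have hE : height e r = d w.
  apply/eqP; rewrite eqn_leq; apply/andP; split.
    apply/bigmax_leqP => n /existsP[p /and3P[p_path p_uniq p_leaf]].
    rewrite -(leaves _ _ p_leaf w_leaf) descending_path // ?size_tuple.
      by rewrite leq_addl.
    move=> y ry; rewrite dist_root leqn0 => /eqP dy.
    by have := edge_levels ry; rewrite dy dist_root.
  have [p p_path [pw pd]] := dist_path w.
  case: (shortenP p_path) pw => q q_path q_uniq q_sub qw.
  have qV := uniq_cons_size q_uniq.
  apply: leq_trans (_ : d w <= size q) _; first by rewrite -qw dist_leq.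
  rewrite /height (bigD1 (Ordinal qV)) ?leq_maxl //=.
  by apply/existsP; exists (in_tuple q); move: q_uniq; rewrite /= q_path qw w_leaf => ->.
split=> [v|v]; rewrite hE //; apply/idP/eqP => [v_leaf|dv]; first exact: leaves.
apply/eqP/setP => u; rewrite !inE; apply/negP => /andP[_ /eqP du].
by have := wmax u; rewrite du dv ltnn.
Qed.

(** Left and right are fixed arbitrarily by [enum]; at a leaf the default [v] is returned. *)
Definition kid (v : V) (b : bool) : V := nth v (enum (children e r v)) b.

Local Notation h := (height e r).

Lemma kidP v : d v < h ->
  [/\ kid v false != kid v true, forall b, e v (kid v b),
      forall b, d (kid v b) = (d v).+1
    & forall u, e v u -> d u = (d v).+1 -> exists b, u = kid v b].
Proof.
move=> dv; have [_ two _] := e_cbt.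
have v_nleaf : ~~ leaf e r v by rewrite cbt_levels.2 neq_ltn dv.
have sz : size (enum (children e r v)) = 2 by rewrite -cardE two.
have kid_child b : kid v b \in children e r v.
  by rewrite -mem_enum mem_nth // sz; case: b.
split=> [|b|b|u vu du].
- by rewrite nth_uniq ?sz ?enum_uniq.
- by have := kid_child b; rewrite inE => /andP[].
- by have := kid_child b; rewrite inE => /andP[_ /eqP].
have : u \in enum (children e r v) by rewrite mem_enum inE vu du eqxx.
case/(nthP v) => i; rewrite sz => i2 <-.
by exists (i == 1); case: i i2 => [|[]].
Qed.

Definition node (s : seq bool) : V := foldl kid r s.

Lemma node_rcons s b : node (rcons s b) = kid (node s) b.
Proof. by rewrite /node foldl_rcons. Qed.

Lemma dist_node s : size s <= h -> d (node s) = size s.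
Proof.
elim/last_ind: s => [|s b IHs]; first by rewrite dist_root.
rewrite size_rcons node_rcons => sh; rewrite -IHs ?(ltnW sh) //.
by have [|_ _ ->] := @kidP (node s); rewrite ?IHs ?(ltnW sh).
Qed.

Lemma node_inj s t : size s <= h -> size t <= h -> node s = node t -> s = t.
Proof.
move=> sh th st; have := dist_node th; rewrite -st dist_node // => sz.
elim/last_ind: s t sh th st sz => [|s b IHs] t; first by case: t.
case/lastP: t => [|t c]; rewrite !size_rcons // !node_rcons => sh th st [sz].
have ds : d (node s) < h by rewrite dist_node ?(ltnW sh).
have dt : d (node t) < h by rewrite dist_node ?(ltnW th).
have [_ /(_ b) se /(_ b) sd _] := kidP ds; have [_ /(_ c) te /(_ c) td _] := kidP dt.
have st' : node s = node t.
  apply: (@unique_parent (kid (node s) b)); rewrite ?sd // 1?e_sym //.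
    by rewrite st.
  by rewrite -sd st td.
have E : s = t by apply: IHs; rewrite ?(ltnW sh) ?(ltnW th).
move: st; rewrite -E; have [neq _ _ _] := kidP ds.
by case: b c {se sd te td} => [] [] // /eqP; rewrite ?(negPf neq) // eq_sym (negPf neq).
Qed.

Lemma node_surj v : exists s, size s <= h /\ node s = v.
Proof.
suff: exists s, size s = d v /\ node s = v.
  by case=> s [sd sv]; exists s; rewrite sd cbt_levels.1.
move: {2}(d v) (erefl (d v)) => n; elim: n v => [|n IHn] v vn.
  exists [::]; rewrite vn; split=> //; apply/eqP; rewrite eq_sym.
  by apply: contra_eqT vn => /ex_parent[y _ ->].
have vr : v != r by apply: contra_eq_neq vn => ->; rewrite dist_root.
have [y vy] := ex_parent vr; rewrite vn => -[yn].
have [s [sd sv]] := IHn y (esym yn).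
have [|_ _ _ kids] := @kidP y; first by rewrite -yn -vn cbt_levels.1.
have [||b vE] := kids v; rewrite 1?e_sym // ?vn ?yn //.
by exists (rcons s b); rewrite size_rcons node_rcons sd sv.
Qed.

Lemma node_edge s t : size s <= h -> size t <= h -> e (node s) (node t) = wadj s t.
Proof.
have half s' t' : size s' <= h -> size t' <= h -> wchild s' t' ->
    e (node s') (node t').
  move=> sh + /wchildP[b tE]; rewrite tE size_rcons node_rcons => th.
  by have [|_ -> _ _] := @kidP (node s'); rewrite ?dist_node.
have conv s' t' : size s' <= h -> size t' <= h -> e (node s') (node t') ->
    d (node t') = (d (node s')).+1 -> wchild s' t'.
  move=> sh th st dt; have := dt; rewrite !dist_node // => sz.
  have [|_ _ _ /(_ _ st dt)[b]] := @kidP (node s').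
    by rewrite dist_node // -sz.
  rewrite -node_rcons => /node_inj-> //; first exact: wchild_rcons.
  by rewrite size_rcons -sz.
move=> sh th; apply/idP/idP => [st|/orP[]st]; last 2 first.
- exact: half.
- by rewrite e_sym; apply: half.
have /orP[] := edge_levels st => /eqP dE; apply/orP; [left|right].
  exact: conv.
by apply: conv; rewrite // e_sym.
Qed.

End Tree.

Lemma cbt_words (V : finType) (e : rel V) (r : V) :
  simple_graph e -> complete_binary_tree e r ->
  exists (f : V -> seq bool) (g : seq bool -> V),
    [/\ cancel f g, forall v, size (f v) <= height e r,
        forall s, size s <= height e r -> f (g s) = s
      & forall u v, e u v = wadj (f u) (f v)].
Proof.
move=> e_simple e_cbt; have [e_tree _ _] := e_cbt.
have [f fP] := fin_all_exists (node_surj e_simple e_tree e_cbt).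
exists f, (node e r).
split=> [v|v|s sh|u v]; [by case: (fP v)|by case: (fP v)| |].
  by case: (fP (node e r s)) => sz; apply: node_inj.
by have [su {1}<-] := fP u; have [sv {1}<-] := fP v; rewrite node_edge.
Qed.

(** * The two bounds on thinness *)

Lemma thin_leq (V : finType) (e lt : rel V) (c : V -> nat) (N : nat) :
  irreflexive lt -> transitive lt -> (forall x y, x != y -> lt x y || lt y x) ->
  (forall x, c x < N) ->
  (forall u v w, lt u v -> lt v w -> c u = c v -> e u w -> e v w) ->
  thin e <= N.
Proof.
move=> irr tr tot cN cons; rewrite /thin; case: ex_minnP => k _ min_k.
pose P := preim_partition c [set: V].
have eqP' : {in [set: V] & &, equivalence_rel [rel x y | c x == c y]}.
  by move=> x y z _ _ _ /=; split=> // /eqP->.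
apply: leq_trans (min_k #|P| _) _.
  apply/k_thinP; exists lt, P; split; split=> //; first exact: preim_partitionP.
  move=> u v w uv vw puv; apply: cons => //; apply/eqP.
  case/and3P: (preim_partitionP c [set: V]) => /eqP cov _ _.
  have : v \in pblock P u by rewrite puv mem_pblock cov inE.
  by rewrite /P pblock_equivalence_partition ?inE.
rewrite -[leqRHS]card_ord -cardsT.
apply: leq_trans (leq_imset_card (fun i : 'I_N => [set y | c y == i]) _).
apply/subset_leq_card/subsetP => B /imsetP[x _ ->].
apply/imsetP; exists (Ordinal (cN x)); rewrite ?inE //.
by apply/setP => y; rewrite !inE eq_sym.
Qed.

Lemma thin_words_leq (V : finType) (e : rel V) (f : V -> seq bool) (h : nat) :
  injective f -> (forall v, size (f v) <= h) ->
  (forall u v, e u v = wadj (f u) (f v)) -> thin e <= (h %/ 3).+1.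
Proof.
move=> f_inj f_size f_adj.
apply: (@thin_leq _ _ (fun x y => word_lt (f x) (f y)) (fun x => size (f x) %/ 3)).
- by move=> x; apply: word_lt_irr.
- by move=> y x z; apply: word_lt_trans.
- by move=> x y xy; apply: word_lt_total; rewrite (inj_eq f_inj).
- by move=> x; rewrite ltnS leq_div2r.
by move=> u v w uv vw cuv; rewrite !f_adj; apply: word_lt_consistent.
Qed.

Lemma thin_words_geq (V : finType) (e : rel V) (f : V -> seq bool)
    (g : seq bool -> V) (h : nat) :
  (forall s, size s <= h -> f (g s) = s) ->
  (forall u v, e u v = wadj (f u) (f v)) -> (h %/ 3).+1 <= thin e.
Proof.
move=> gK f_adj; rewrite /thin; case: ex_minnP => k + _.
case/k_thinP=> lt [P [[irr tr tot] [/and3P[/eqP cov triv _] <- cons]]].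
pose wlt s t := lt (g s) (g t).
have wlt_total s t : size s <= h -> size t <= h -> s != t -> wlt s t = ~~ wlt t s.
  move=> sh th st; have gst : g s != g t.
    by apply: contraNneq st => gst; rewrite -(gK s) // gst gK.
  have := tot _ _ gst; rewrite /wlt.
  case st': (lt (g s) (g t)); case ts: (lt (g t) (g s)) => // _.
  by have := irr (g s); rewrite (tr _ _ _ st' ts).
have [|t [m [/andP[_ th] mk sep cross]]] := @ex_witness wlt h wlt_total (h %/ 3) [::].
  by rewrite add0n mulnC leq_trunc_div.
pose blk s := pblock P (g s).
have cons_w a b d : size a <= h -> size b <= h -> size d <= h ->
    wlt a b -> wlt b d -> blk a = blk b -> wadj a d -> wadj b d.
  move=> ah bh dh ab bd Eab; rewrite -{1}(gK a) // -{1}(gK d) // -f_adj.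
  by move/(cons _ _ _ ab bd Eab); rewrite f_adj !gK.
have blk_uniq : uniq (map blk (t :: map fst m)).
  rewrite /= -map_comp; apply/andP; split.
    apply/negP=> /mapP[p /(allP cross)].
    case/and5P=> /andP[_ p1] /andP[_ p2] padj lt1 /andP[lt2 nadj] /= E.
    by case/negP: nadj; apply: cons_w padj.
  elim: m sep cross {mk} => //= p m IHm /andP[sep_p sep_m] /andP[cr_p cr_m].
  rewrite IHm // andbT; apply/negP=> /mapP[q qm /= E].
  have /andP[pq qp] := allP sep_p q qm.
  case/and5P: (allP cr_m q qm) => /andP[_ q1] /andP[_ q2] qadj qlt1 /andP[qlt2 _].
  case/and5P: cr_p => /andP[_ p1] /andP[_ p2] padj plt1 /andP[plt2 _].
  have [E1|neq] := eqVneq p.1 q.1; first by rewrite E1 qadj in pq.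
  (* If [p.1] < [q.1], then [q.1] < [t] < [p.2], so a common block would make [q.1] adjacent to
     [p.2], against separation; the other case is symmetric. *)
  case ltpq: (wlt p.1 q.1).
    case/negP: qp; apply: cons_w ltpq _ E padj => //.
    exact: tr qlt1 plt2.
  have ltqp : wlt q.1 p.1 by rewrite wlt_total 1?eq_sym // ltpq.
  case/negP: pq; apply: cons_w ltqp _ (esym E) qadj => //.
  exact: tr plt1 qlt2.
have -> : (h %/ 3).+1 = size (map blk (t :: map fst m)).
  by rewrite size_map /= size_map mk.
rewrite -(card_uniqP blk_uniq); apply/subset_leq_card/subsetP => B.
by case/mapP=> s _ ->; rewrite pblock_mem // cov inE.
Qed.

(** With [h] = 3q + r and r < 3, the quotient is q + (r + 1)/3, which lies above q and is at most q
    + 1. *)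
Lemma ceil_succ_div3 (h : nat) :
  (Num.ceil ((h%:R + 1) / 3%:R : rat) = Posz (h %/ 3).+1)%R.
Proof.
apply: ceil_def.
have -> : (h%:R = (h %/ 3)%:R * 3 + (h %% 3)%:R :> rat)%R.
  by rewrite {1}(divn_eq h 3) natrD natrM.
have : ((h %% 3)%:R + 1 <= 3 :> rat)%R by rewrite natr1 ler_nat ltn_mod.
have : (0 <= (h %% 3)%:R :> rat)%R by rewrite ler0n.
rewrite rmorphB /= -!pmulrn -(natr1 (h %/ 3)).
by move: ((h %% 3)%:R)%R ((h %/ 3)%:R)%R => a b ? ?; apply/andP; split; lra.
Qed.

Theorem theorem20 (V : finType) (e : rel V) (r : V) (h : nat)
    (e_simple : simple_graph e)
    (e_cbt : complete_binary_tree e r)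
    (e_height : height e r = h) :
  ((thin e)%:Z = Num.ceil ((h%:R + 1) / 3%:R : rat))%R.
Proof.
have [f [g [fK f_size gK f_adj]]] := cbt_words e_simple e_cbt.
rewrite e_height in f_size gK.
rewrite ceil_succ_div3; congr Posz.
apply/eqP; rewrite eqn_leq (thin_words_leq (can_inj fK) f_size f_adj).
exact: thin_words_geq gK f_adj.
Qed.
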